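(* Let $X$ and $Y$ be Fréchet Dacey spaces and let $f \colon X \to Y$ and $g \colon Y \to X$ be maps such that $g$ is an adjoint of $f$. Then: (i) $f$ is a partial orthometry if and only if $f = f \circ g \circ f$. (ii) $f$ is an orthometry if and only if $g \circ f = \mathrm{id}_X$. (iii) $f$ is a coorthometry if and only if $f \circ g = \mathrm{id}_Y$. In each of these cases, $g$ is the generalised inverse of $f$.
   Context: An orthoset (with $0$) is a non-empty set $X$ with a binary relation $\perp$ and a distinguished element $0$ such that: $x \perp y$ implies $y \perp x$; $x \perp x$ iff $x = 0$; $0 \perp x$ for all $x$. Elements $\neq 0$ are proper. For $A \subseteq X$, $A^\perp = \{x : x \perp y \ \forall y \in A\}$; subspaces are the sets $A$ with $A = A^{\perp\perp}$, and $\mathsf{C}(X)$ is the ortholattice of subspaces. A subset containing $0$ with the restricted relation is an orthoset. $X$ is Fréchet if for any distinct proper $x,y$ there is $z$ with $z \perp x$ and $z \not\perp y$. $X$ is Dacey if $\mathsf{C}(X)$ is orthomodular. A map $g \colon Y \to X$ is an adjoint of $f \colon X \to Y$ if $f(x) \perp y \iff x \perp g(y)$ for all $x,y$. An orthoisomorphism is a bijection $h$ with $h(0)=0$ and $x \perp y \iff h(x) \perp h(y)$. $\ker f = \{x : f(x) = 0\}$, $\operatorname{im} f = f(X)$. A map $f \colon X \to Y$ is a partial orthometry if it has an adjoint $g$ (called a generalised inverse of $f$) such that there are subspaces $A$ of $X$ and $B$ of $Y$ with $A^\perp = \ker f$, $B^\perp = \ker g$, and $f$, $g$ restrict to mutually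 inverse orthoisomorphisms between $A$ and $B$. An orthometry is an injective partial orthometry; a coorthometry is a surjective partial orthometry. *)

(* Defs.v *)
From mathcomp Require Import all_boot.
From mathcomp Require Import boolp classical_sets functions.

Set Implicit Arguments.
Unset Strict Implicit.
Unset Printing Implicit Defensive.

Local Open Scope classical_set_scope.

(* Non-emptiness of the carrier is witnessed by [ozero]. *)
Record orthoset : Type := Orthoset {
  ocarrier :> Type;
  orth : ocarrier -> ocarrier -> Prop;
  ozero : ocarrier;
  orth_sym : forall x y, orth x y -> orth y x;
  orth_self : forall x, orth x x <-> x = ozero;
  orth_zero : forall x, orth ozero x
}.

Arguments ozero {_}.

Notation "x ⊥ y" := (orth x y) (at level 70, no associativity).

Section Subspaces.
Variable X : orthoset.
Implicit Types (A B C : set X) (x y z : X).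

Definition proper_elt x : Prop := x <> ozero.

Definition ocompl A : set X := [set x | forall y, A y -> x ⊥ y].

Definition is_subspace A : Prop := A = ocompl (ocompl A).

(* The ortholattice C(X) consists of the sets satisfying [is_subspace],
   ordered by inclusion.  Its meet is intersection, its join is [ojoin] and its
   orthocomplementation is [ocompl]; the lemmas below justify this. *)
Definition ojoin A B : set X := ocompl (ocompl (A `|` B)).

Lemma ocomplS A B : A `<=` B -> ocompl B `<=` ocompl A.
Proof. by move=> sAB x xB y /sAB; apply: xB. Qed.

Lemma sub_ocomplK A : A `<=` ocompl (ocompl A).
Proof. by move=> x Ax y yA; apply: orth_sym; apply: yA. Qed.

Lemma is_subspace_ocompl A : is_subspace (ocompl A).
Proof.
apply/seteqP; split; first exact: sub_ocomplK.
by apply: ocomplS; apply: sub_ocomplK.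
Qed.

Lemma is_subspaceI A B :
  is_subspace A -> is_subspace B -> is_subspace (A `&` B).
Proof.
move=> sA sB; apply/seteqP; split; first exact: sub_ocomplK.
move=> x ABx; split.
- by rewrite sA; apply: ocomplS ABx; apply: ocomplS => y [].
- by rewrite sB; apply: ocomplS ABx; apply: ocomplS => y [].
Qed.

Lemma is_subspace_ojoin A B : is_subspace (ojoin A B).
Proof. exact: is_subspace_ocompl. Qed.

Lemma ojoin_lub A B C :
  is_subspace C -> ojoin A B `<=` C <-> A `<=` C /\ B `<=` C.
Proof.
move=> sC; split=> [sABC | [sAC sBC]].
- by split=> x ABx; apply/sABC/sub_ocomplK; [left | right].
- by rewrite sC; apply/ocomplS/ocomplS => x []; [apply: sAC | apply: sBC].
Qed.

Lemma ocompl_meet A : A `&` ocompl A `<=` [set ozero].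
Proof. by move=> x [Ax xA]; apply/orth_self/xA. Qed.

Lemma ocompl_join A : ojoin A (ocompl A) = [set: X].
Proof.
apply/seteqP; split=> // x _ y yAA.
have yA : ocompl A y by move=> z Az; apply: yAA; left.
have /orth_self -> : y ⊥ y by apply: yAA; right.
exact/orth_sym/orth_zero.
Qed.

Definition orthomodular_subspaces : Prop :=
  forall A B, is_subspace A -> is_subspace B -> A `<=` B ->
    ojoin A (B `&` ocompl A) = B.

End Subspaces.

Definition frechet (X : orthoset) : Prop :=
  forall x y : X, proper_elt x -> proper_elt y -> x <> y ->
    exists z : X, z ⊥ x /\ ~ z ⊥ y.

Definition dacey (X : orthoset) : Prop := orthomodular_subspaces X.

Section Maps.
Variables X Y : orthoset.
Implicit Types (f : X -> Y) (g : Y -> X).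

Definition is_adjoint f g : Prop := forall x y, f x ⊥ y <-> x ⊥ g y.

Definition oker f : set X := [set x | f x = ozero].

(* [h] restricts to an orthoisomorphism between [A] and [B], which are
   orthosets under the restricted relation and with the same zero. *)
Definition orthoiso_on (A : set X) (B : set Y) (h : X -> Y) : Prop :=
  [/\ A ozero, B ozero, set_bij A B h, h ozero = ozero &
      forall x y, A x -> A y -> x ⊥ y <-> h x ⊥ h y].

End Maps.

Section PartialOrthometries.
Variables X Y : orthoset.
Implicit Types (f : X -> Y) (g : Y -> X).

Definition generalised_inverse f g : Prop :=
  is_adjoint f g /\
  exists (A : set X) (B : set Y),
    [/\ is_subspace A, is_subspace B, ocompl A = oker f & ocompl B = oker g] /\
    [/\ orthoiso_on A B f, orthoiso_on B A g,
        {in A, cancel f g} & {in B, cancel g f}].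

Definition partial_orthometry f : Prop := exists g, generalised_inverse f g.

Definition orthometry f : Prop := partial_orthometry f /\ injective f.

Definition coorthometry f : Prop :=
  partial_orthometry f /\ range f = [set: Y].

End PartialOrthometries.

(* Main.v *)
(* A map f between Fréchet spaces has at most one adjoint g, so f = f g f gives
   g = g f g, and e = g f is a self-adjoint idempotent with kernel ker f.  The
   point is that e fixes (ker e)^⊥: if x in (ker e)^⊥ differs from y = e x, then
   orthomodularity provides a proper u in {x, y}^⊥⊥ with u ⊥ y.  As e u is
   orthogonal to both x and y, it is orthogonal to u, whence e u ⊥ e u and u is
   in ker e.  But u is also in (ker e)^⊥, a contradiction. *)
Require Import Defs.
From mathcomp Require Import all_boot.
From mathcomp Require Import boolp classical_sets functions.

Set Implicit Arguments.
Unset Strict Implicit.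

Local Open Scope classical_set_scope.

Lemma orth0r (X : orthoset) (x : X) : x ⊥ ozero.
Proof. exact/orth_sym/orth_zero. Qed.

(** A proper [y] other than [x] would admit some [z] with [z ⊥ y] but not [z ⊥ x]; for [y] zero, [x]
    would be orthogonal to itself. *)
Lemma frechet_ocompl1K (X : orthoset) (x y : X) :
  frechet X -> proper_elt x -> ocompl (ocompl [set y]) x -> x = y.
Proof.
move=> frX x0 xyy; apply: contrapT => xy.
have [y0|y0] := pselect (y = ozero).
  apply/x0/orth_self/xyy => _ ->; rewrite y0; exact: orth0r.
have [z [zy nzx]] := frX y x y0 x0 (fun yx => xy (esym yx)).
by apply: nzx; apply/orth_sym/xyy => _ ->.
Qed.

Lemma frechet_ext (X : orthoset) (x y : X) :
  frechet X -> (forall z, z ⊥ x <-> z ⊥ y) -> x = y.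
Proof.
move=> frX xy; have [x0|x0] := pselect (x = ozero).
  by subst x; apply/esym/orth_self/xy/orth0r.
by apply: frechet_ocompl1K => // z zy; apply/orth_sym/xy/zy.
Qed.

Section Adjoints.
Variables X Y : orthoset.
Implicit Types (f : X -> Y) (g : Y -> X).

Lemma adjoint_sym f g : is_adjoint f g -> is_adjoint g f.
Proof.
by move=> fg y x; split=> /orth_sym/fg/orth_sym.
Qed.

Lemma adjoint_unique f g g' :
  frechet X -> is_adjoint f g -> is_adjoint f g' -> g = g'.
Proof.
move=> frX fg fg'; apply/funext => y; apply: frechet_ext => // z.
by split=> [/fg/fg'|/fg'/fg].
Qed.

Lemma adjoint0 f g : is_adjoint f g -> f ozero = ozero.
Proof. by move=> fg; apply/orth_self/fg/orth_zero. Qed.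

(** If [x] is orthogonal to [g (f x)], then [f x ⊥ f x]. This makes kernels subspaces. *)
Lemma oker_adjoint f g : is_adjoint f g -> oker f = ocompl (range g).
Proof.
move=> fg; apply/seteqP; split=> x.
  by move=> fx0 _ [y _ <-]; apply/fg; rewrite fx0; apply: orth_zero.
by move=> xg; apply/orth_self/fg/xg; exists (f x).
Qed.

Lemma is_subspace_oker f g : is_adjoint f g -> is_subspace (oker f).
Proof. by move=> /oker_adjoint ->; apply: is_subspace_ocompl. Qed.

Lemma range_sub_ocompl_oker f g :
  is_adjoint f g -> range f `<=` ocompl (oker g).
Proof.
by move=> fg _ [x _ <-] y gy0; apply/fg; rewrite gy0; apply: orth0r.
Qed.

(** [g \o f \o g] is an adjoint of [f \o g \o f], hence of [f]. *)
Lemma adjoint_regular f g :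
  frechet X -> is_adjoint f g -> f = f \o g \o f -> g = g \o f \o g.
Proof.
move=> frX fg fE; apply: (adjoint_unique frX fg) => x y; rewrite {1}fE.
apply: iff_trans (fg (g (f x)) y) _.
exact: iff_trans (adjoint_sym fg _ _) (fg x _).
Qed.

(** Adjointness turns [f x ⊥ f x'] into [x ⊥ g (f x')], that is, [x ⊥ x']. *)
Lemma orthoiso_on_cancel f g (A : set X) (B : set Y) :
  is_adjoint f g -> A ozero -> B ozero ->
  (forall x, A x -> B (f x)) -> (forall y, B y -> A (g y)) ->
  (forall x, A x -> g (f x) = x) -> (forall y, B y -> f (g y) = y) ->
  orthoiso_on A B f.
Proof.
move=> fg A0 B0 fAB gBA fK gK; split=> //; last 2 first.
- exact: adjoint0 fg.
- by move=> x x' Ax Ax'; rewrite (fg x (f x')) fK.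
split=> //.
- by move=> x x' /set_mem Ax /set_mem Ax' ff; rewrite -(fK x) // ff fK.
- by move=> y By; exists (g y); [apply: gBA | apply: gK].
Qed.

End Adjoints.

Lemma selfadjoint_idem_fix (X : orthoset) (e : X -> X) (x : X) :
  frechet X -> dacey X -> is_adjoint e e -> e \o e = e ->
  ocompl (oker e) x -> e x = x.
Proof.
move=> frX daX ee eK xA; pose y := e x.
have ey : e y = y by rewrite -[e y]/((e \o e) x) eK.
have yA : ocompl (oker e) y by apply: (range_sub_ocompl_oker ee); exists x.
have [->|x0] := pselect (x = ozero); first exact: adjoint0 ee.
apply/esym/frechet_ocompl1K => //; rewrite -/y.
pose P := ocompl (ocompl [set x; y]).
have yP : ocompl (ocompl [set y]) `<=` P.
  by apply/ocomplS/ocomplS => _ ->; right.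
have Px : P x by apply: sub_ocomplK; left.
have := daX _ P (is_subspace_ocompl _) (is_subspace_ocompl _) yP.
move=> PE; move: Px; rewrite -PE => {PE}.
(* With a trivial relative complement, orthomodularity collapses [P] to the closure of [y], which
   then contains [x]. *)
have -> : P `&` ocompl (ocompl (ocompl [set y])) = [set ozero].
  apply/seteqP; split; last first.
    by move=> _ ->; split=> z _; apply: orth_zero.
  rewrite -is_subspace_ocompl => u [Pu uy].
  have eu0 : e u = ozero.
    apply/orth_self/ee; rewrite -[e (e u)]/((e \o e) u) eK.
    apply: Pu => _ [|] ->; apply/ee; rewrite -/y ?ey; exact: uy.
  (* Both [x] and [y] lie in the subspace [ocompl (oker e)], so it contains [P]. *)
  apply/orth_self; suff : ocompl (oker e) u by apply.
  rewrite (is_subspace_ocompl (oker e)); apply: ocomplS Pu.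
  by apply: ocomplS => _ [|] ->.
apply: (ojoin_lub _ _ (is_subspace_ocompl (ocompl [set y]))).2; split=> //.
by move=> _ -> z _; apply: orth_zero.
Qed.

Section Regular.
Variables (X Y : orthoset) (f : X -> Y) (g : Y -> X).

Lemma regular_cancel : frechet X -> dacey X ->
  is_adjoint f g -> f = f \o g \o f ->
  forall x, ocompl (oker f) x -> g (f x) = x.
Proof.
move=> frX daX fg fE x xA.
apply: (selfadjoint_idem_fix (e := g \o f)) => //.
- move=> a b; exact: iff_trans (adjoint_sym fg (f a) b) (fg a (f b)).
- by rewrite [in RHS]fE.
(* Regularity puts the kernel of [g \o f] inside that of [f]. *)
apply: ocomplS xA => z; rewrite /oker /= => gfz0.
by rewrite fE /= gfz0; apply: adjoint0 fg.
Qed.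

(** The range of [f] lies in the complement of [oker g], which is [B], and there [f] inverts [g]. *)
Lemma generalised_inverse_regular :
  generalised_inverse f g -> f = f \o g \o f.
Proof.
move=> [fg [A [B [[_ sB _ kg] [_ _ _ gK]]]]]; apply/funext => x /=.
rewrite gK //; apply/mem_set; rewrite sB kg.
by apply: (range_sub_ocompl_oker fg); exists x.
Qed.

End Regular.

Lemma regular_generalised_inverse (X Y : orthoset) (f : X -> Y) (g : Y -> X) :
  frechet X -> dacey X -> frechet Y -> dacey Y ->
  is_adjoint f g -> f = f \o g \o f -> generalised_inverse f g.
Proof.
move=> frX daX frY daY fg fE; have gf := adjoint_sym fg.
have fK := regular_cancel frX daX fg fE.
have gK := regular_cancel frY daY gf (adjoint_regular frX fg fE).
have fB x : ocompl (oker g) (f x).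
  by apply: (range_sub_ocompl_oker fg); exists x.
have gA y : ocompl (oker f) (g y).
  by apply: (range_sub_ocompl_oker gf); exists y.
have ocompl0 (Z : orthoset) (C : set Z) : ocompl C ozero.
  by move=> z _; apply: orth_zero.
(* The choice is forced: subspaces with complements [oker f] and [oker g] must be these. *)
split=> //; exists (ocompl (oker f)), (ocompl (oker g)); split; split.
- exact: is_subspace_ocompl.
- exact: is_subspace_ocompl.
- exact/esym/(is_subspace_oker fg).
- exact/esym/(is_subspace_oker gf).
- exact: orthoiso_on_cancel fg _ _ _ _ fK gK.
- exact: orthoiso_on_cancel gf _ _ _ _ gK fK.
- by move=> x /set_mem; apply: fK.
- by move=> y /set_mem; apply: gK.
Qed.

Theorem theorem4p12 (X Y : orthoset)
    (frechetX : frechet X) (daceyX : dacey X)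
    (frechetY : frechet Y) (daceyY : dacey Y)
    (f : X -> Y) (g : Y -> X) (adj_fg : is_adjoint f g) :
  (partial_orthometry f <-> f = f \o g \o f) /\
  (orthometry f <-> g \o f = id) /\
  (coorthometry f <-> f \o g = id) /\
  (partial_orthometry f \/ orthometry f \/ coorthometry f ->
     unique (generalised_inverse f) g).
Proof.
(* The witness hidden in [partial_orthometry] is itself an adjoint of [f], hence equal to [g]. *)
have ginv_g g' : generalised_inverse f g' -> g = g'.
  by move=> [fg' _]; apply: adjoint_unique fg'.
have poE : partial_orthometry f <-> f = f \o g \o f.
  split=> [[g' fg']|fE].
    by rewrite (ginv_g _ fg'); apply: generalised_inverse_regular.
  by exists g; apply: regular_generalised_inverse.
split=> //; split; [|split].
- split=> [[/poE fE f_inj]|gfE].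
    by apply/funext => x; apply: f_inj; rewrite [in RHS]fE.
  split; first by apply/poE; rewrite -compA gfE.
  by apply: (can_inj (g := g)) => x; rewrite -[LHS]/((g \o f) x) gfE.
- split=> [[/poE fE f_surj]|fgE].
    apply/funext => y; have [x _ <-] : range f y by rewrite f_surj.
    by rewrite [in RHS]fE.
  split; first by apply/poE; rewrite fgE.
  by apply/seteqP; split=> // y _; exists (g y) => //;
    rewrite -[LHS]/((f \o g) y) fgE.
- move=> fpo; have {fpo} /poE fE : partial_orthometry f.
    by case: fpo => [//|[[]|[]]].
  by split=> //; apply: regular_generalised_inverse.
Qed.
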